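(* Let $\mathbf s=(s_1,\dots,s_l)$ be a sequence of positive integers with $\mathbf s\neq(1)$. Then $$T(\mathbf s)=\sum_{i\in S_1(\mathbf s)}T(s_1,\dots,s_i-1,\dots,s_l)+\sum_{i\in S_2(\mathbf s)}T(s_1,\dots,s_{i-1},s_i+s_{i+1}-1,s_{i+2},\dots,s_l),$$ with the initial condition $T(1)=1$. Here, in the term $i=l$ of the first sum, if $s_l=1$ the resulting last entry $0$ is deleted, i.e. the argument is $(s_1,\dots,s_{l-1})$.
   Context: A noncommutative crossing partition of $[n]=\{1,\dots,n\}$ is a finite sequence $\pi=(\pi_1,\dots,\pi_l)$ of nonempty blocks such that each $p\in[n]$ appears exactly once in $\pi$, each block is written as an increasing sequence, and $\max(\pi_i)>\min(\pi_{i+1})$ for $1\le i\le l-1$. It is of type $(s_1,\dots,s_l)$ if $\pi_i$ has $s_i$ elements for each $i$. For a sequence $\mathbf s=(s_1,\dots,s_l)$ of positive integers with sum $n$, $T(\mathbf s)$ is the number of noncommutative crossing partitions of $[n]$ of type $\mathbf s$. Define $$S_1(\mathbf s)=\{i\le l-1: s_i>1\}\cup\{l\},\qquad S_2(\mathbf s)=\{i\le l-1: s_{i+1}\ge2\}.$$ *)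

(* Defs.v *)
From mathcomp Require Import all_boot.

Set Implicit Arguments.
Unset Strict Implicit.
Unset Printing Implicit Defensive.

(* The ground set [n] = {1, ..., n} is modelled by 'I_n, i.e. shifted to
   {0, ..., n-1}; only the order of its elements matters. A block written as an
   increasing sequence is the same data as a set. *)

Definition block_max (n : nat) (B : {set 'I_n}) : nat := \max_(x in B) x.

(* The default value n is only reached by the empty set. *)
Definition block_min (n : nat) (B : {set 'I_n}) : nat :=
  \big[minn/n]_(x in B) (x : nat).

Definition nc_crossing_partition (n : nat) (pi : seq {set 'I_n}) : bool :=
  [&& all (fun B : {set 'I_n} => B != set0) pi,
      [forall p : 'I_n, count (fun B : {set 'I_n} => p \in B) pi == 1]
    & sorted (fun A B : {set 'I_n} => block_max A > block_min B) pi].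

Definition has_type (n : nat) (pi : seq {set 'I_n}) (s : seq nat) : bool :=
  [seq #|B : {set 'I_n}| | B <- pi] == s.

(* Sequences of type s necessarily have length size s, so nothing is lost by
   counting tuples. *)
Definition T (s : seq nat) : nat :=
  #|[set pi : (size s).-tuple {set 'I_(sumn s)} |
      nc_crossing_partition pi && has_type pi s]|.

(* Positions in s are numbered from 0: the i-th entry s_i of the mathematical
   text is nth 0 s i.-1, and its index l is the i with i.+1 = size s. *)

Definition S1 (s : seq nat) : {set 'I_(size s)} :=
  [set i : 'I_(size s) | (i.+1 < size s) && (nth 0 s i > 1)]
    :|: [set i : 'I_(size s) | i.+1 == size s].

Definition S2 (s : seq nat) : {set 'I_(size s)} :=
  [set i : 'I_(size s) | (i.+1 < size s) && (nth 0 s i.+1 >= 2)].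

(* An entry equal to 1 is deleted instead of being replaced by 0; for i in S1 s
   this only happens at the last position. *)
Definition decrease (s : seq nat) (i : nat) : seq nat :=
  take i s ++ (if nth 0 s i == 1 then [::] else [:: nth 0 s i - 1])
    ++ drop i.+1 s.

Definition merge_next (s : seq nat) (i : nat) : seq nat :=
  take i s ++ (nth 0 s i + nth 0 s i.+1 - 1) :: drop i.+2 s.

(* Main.v *)
Require Import Defs.
From HB Require Import structures.
From mathcomp Require Import all_boot zify.

Set Implicit Arguments.
Unset Strict Implicit.
Unset Printing Implicit Defensive.

(* Concatenating the blocks of a noncommutative crossing partition of type s
   gives a permutation whose descents are exactly at the block boundaries, since
   the last entry of a block is its maximum and the first one its minimum; so
   T s counts the permutations with a prescribed descent set. Deleting the
   smallest value, which must open a block, replaces the pattern "descent,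
   ascent" around it by a single descent (that block loses an element) or a
   single ascent (it is merged with the previous block). *)

(** * Descents of words and the insertion of a new minimum *)

Definition descents (x0 : nat) (w : seq nat) : bitseq :=
  pairmap (fun a b => b < a) x0 w.

Definition descent_word (s : seq nat) : bitseq :=
  flatten [seq true :: nseq x.-1 false | x <- s].

(* The initial value [size u] exceeds all entries, so a virtual descent opens
   every nonempty word and the first block is treated like the others. *)
Definition descent_count (u : bitseq) : nat :=
  count (fun w => descents (size u) w == u) (permutations (iota 0 (size u))).

Definition insert_min (k : nat) (w : seq nat) : seq nat :=
  take k (map S w) ++ 0 :: drop k (map S w).

Lemma size_descents x0 w : size (descents x0 w) = size w.
Proof. exact: size_pairmap. Qed.

Lemma descents_cat x0 v w :
  descents x0 (v ++ w) = descents x0 v ++ descents (last x0 v) w.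
Proof. exact: pairmap_cat. Qed.

Lemma descents_succ x0 w : descents x0.+1 (map S w) = descents x0 w.
Proof. by elim: w x0 => //= y w IHw x0; rewrite IHw. Qed.

(** The new 0 separates two neighbours of [w]. Their comparison, letter [k], is lost and gives way
    to a descent into 0 and an ascent out of it. At [k = n] nothing follows the 0, so no letter is
    lost and only the descent is added. *)
Lemma descents_insert_min n k w : size w = n ->  k <= n ->
  descents n.+1 (insert_min k w) =
  take k (descents n w) ++
    true :: (if k < n then false :: drop k.+1 (descents n w) else [::]).
Proof.
move=> sw; rewrite /insert_min -map_take -map_drop => le_kn.
rewrite descents_cat last_map descents_succ /=; congr (_ ++ _ :: _).
  by rewrite -{2}(cat_take_drop k w) descents_cat take_size_cat // size_descents
    size_takel // sw.
case: ltnP => [lt_kn | ge_kn]; last by rewrite drop_oversize ?sw.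
rewrite (drop_nth 0) ?sw //= descents_succ; congr cons.
rewrite -{3}(cat_take_drop k w) descents_cat drop_cat size_descents.
rewrite size_takel ?sw // ltnNge leqnSn /= subSn // subnn.
by rewrite (@drop_nth _ 0 k) ?sw //= drop0.
Qed.

(** The entries of [w] are shifted up, so [k] is recovered as the index of the only 0. *)
Lemma insert_min_inj n k1 k2 w1 w2 :
  size w1 = n -> size w2 = n -> k1 <= n -> k2 <= n ->
  insert_min k1 w1 = insert_min k2 w2 -> k1 = k2 /\ w1 = w2.
Proof.
have idx k w : size w = n -> k <= n -> index 0 (insert_min k w) = k.
  move=> sw le_kn; rewrite /insert_min index_cat ifN /=.
    by rewrite size_takel ?addn0 // size_map sw.
  by apply/negP => /mem_take /mapP[].
move=> s1 s2 le1 le2 eq12.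
have eqk : k1 = k2 by rewrite -(idx k1 w1) // eq12 idx.
split=> //; move: eq12; rewrite -{}eqk /insert_min => /eqP.
rewrite eqseq_cat; last by rewrite !size_takel // size_map ?s1 ?s2.
case/andP=> /eqP e1 /eqP [e2]; apply: (inj_map succn_inj).
by rewrite -(cat_take_drop k1 (map S w1)) e1 e2 cat_take_drop.
Qed.

(** The inverse operation deletes the 0 and lowers all other entries by one. *)
Lemma perm_permutations_insert_min n :
  perm_eq (permutations (iota 0 n.+1))
    [seq insert_min k w | k <- iota 0 n.+1, w <- permutations (iota 0 n)].
Proof.
have sz w : w \in permutations (iota 0 n) -> size w = n.
  by rewrite mem_permutations => /perm_size; rewrite size_iota.
apply: uniq_perm; first exact: permutations_uniq.
  apply: allpairs_uniq; rewrite ?iota_uniq ?permutations_uniq //.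
  move=> _ _ /allpairsP[[k w] [kP wP ->]] /allpairsP[[k' w'] [kP' wP' ->]] /=.
  rewrite !mem_iota /= !add0n !ltnS in kP kP'.
  by case/(insert_min_inj (sz _ wP) (sz _ wP') kP kP') => /= -> ->.
move=> v; rewrite mem_permutations; apply/idP/allpairsP => [vP | [[k w] [kP]]].
  have v0 : 0 \in v by rewrite (perm_mem vP) mem_iota.
  case/splitPr: v0 vP => a b; rewrite perm_catC /= perm_cons => abP.
  have iotaS : iota 1 n = map S (iota 0 n) by rewrite (iotaDl 1 0).
  have pos x : x \in a ++ b -> x = x.-1.+1.
    by rewrite mem_cat orbC -mem_cat (perm_mem abP) mem_iota => /andP[]; case: x.
  have eab : map S (map predn (a ++ b)) = a ++ b.
    by rewrite -map_comp; apply: map_id_in => x /pos /esym.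
  exists (size a, map predn (a ++ b)); split.
  - rewrite -[0 :: _]/(iota 0 n.+1) mem_iota add0n ltnS /=; move/perm_size: abP.
    by rewrite size_cat size_iota => <-; rewrite leq_addl.
  - rewrite /= mem_permutations; apply: (perm_map_inj succn_inj).
    by rewrite eab -iotaS perm_catC.
  by rewrite /insert_min /= eab take_size_cat ?drop_size_cat.
rewrite mem_permutations => wP ->; rewrite /insert_min perm_catC /=.
rewrite perm_cons perm_catC cat_take_drop (iotaDl 1 0).
exact: perm_map.
Qed.

(* Number of words whose descent word becomes [u] when the minimum is inserted
   at position [k], provided [u] has a descent there. *)
Definition insertion_count (u : bitseq) (k : nat) : nat :=
  if k.+1 == size u then descent_count (take k u)
  else if nth false u k.+1 then 0
  else descent_count (take k u ++ true :: drop k.+2 u)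
       + descent_count (take k u ++ false :: drop k.+2 u).

(** Around the inserted minimum the letters are forced: [true] at [k] and, unless [k] is the last
    position, [false] at [k.+1]. The remaining letters of [u] must be those of [w]. *)
Lemma count_insert_min u k : k < size u ->
  count (fun w => descents (size u) (insert_min k w) == u)
    (permutations (iota 0 (size u).-1))
  = nth false u k * insertion_count u k.
Proof.
case def_n: (size u) => [|n] //; rewrite ltnS => le_kn /=.
have sz w : w \in permutations (iota 0 n) -> size w = n.
  by rewrite mem_permutations => /perm_size; rewrite size_iota.
rewrite /insertion_count def_n eqSS.
have szk : size (take k u) = k by rewrite size_takel // def_n ltnW.
case: eqVneq => [ekn | nekn].
  rewrite /descent_count szk -{}ekn in def_n sz *.
  transitivity (count (fun w => nth false u k && (descents k w == take k u))
                  (permutations (iota 0 k))).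
    apply: eq_in_count => w /sz sw; rewrite descents_insert_min // ltnn.
    rewrite take_oversize ?size_descents ?sw //.
    rewrite -{1}(cat_take_drop k u) eqseq_cat ?szk ?size_descents ?sw //.
    rewrite (drop_nth false) ?def_n // drop_oversize ?def_n //=.
    by rewrite eqseq_cons eqxx andbT andbC; case: nth.
  by case: nth; rewrite ?mul1n // count_pred0.
have {nekn le_kn} lt_kn : k < n by rewrite ltn_neqAle nekn.
(* Letter [k] of [descents n w] is lost in the insertion, so it may be either boolean. *)
transitivity (count (fun w => [&& nth false u k, ~~ nth false u k.+1 &
    (descents n w == take k u ++ true :: drop k.+2 u)
     || (descents n w == take k u ++ false :: drop k.+2 u)])
                  (permutations (iota 0 n))).
  apply: eq_in_count => w /sz sw; rewrite (descents_insert_min sw (ltnW lt_kn)) lt_kn.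
  have sd : size (descents n w) = n by rewrite size_descents.
  move: (descents n w) sd => p sp.
  have stp : size (take k p) = k by rewrite size_takel // sp ltnW.
  rewrite -[in X in _ == X](cat_take_drop k u) eqseq_cat ?szk ?stp //.
  rewrite -[in RHS](cat_take_drop k p) !eqseq_cat ?szk ?stp //.
  rewrite (@drop_nth _ false k u) ?def_n 1?ltnS ?(ltnW lt_kn) //.
  rewrite (@drop_nth _ false k.+1 u) ?def_n //.
  rewrite (@drop_nth _ false k p) ?sp // !eqseq_cons.
  case: (take k p == _) => /=; last by rewrite !andbF.
  by case: nth; case: nth; case: nth => //=; rewrite ?orbF.
have szc c : size (take k u ++ c :: drop k.+2 u) = n.
  by rewrite size_cat szk /= size_drop def_n; lia.
rewrite /descent_count !szc.
case: nth; last by rewrite count_pred0.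
case: nth; first by rewrite count_pred0.
(* The two patterns differ in letter [k], so the events are disjoint and their counts add up. *)
rewrite mul1n /= -count_predUI [X in _ = _ + X](@eq_count _ _ pred0) ?count_pred0 ?addn0 //.
move=> w /=; apply/negP => /andP[/eqP-> /eqP/eqP].
by rewrite eqseq_cat // eqxx.
Qed.

(** The permutations are sorted by the position [k] of their minimum. *)
Lemma descent_count_rec u : u != [::] ->
  descent_count u = \sum_(k < size u) nth false u k * insertion_count u k.
Proof.
move=> u0; have def_n : size u = (size u).-1.+1 by case: u u0.
rewrite /descent_count {2}def_n.
rewrite (permP (perm_permutations_insert_min _)) count_flatten -def_n.
rewrite -map_comp sumnE big_map -[X in iota 0 X]subn0 -/(index_iota 0 _) big_mkord.
apply: eq_bigr => k _ /=; rewrite count_map -count_insert_min //.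
Qed.

(** The virtual initial value exceeds the first entry, so a word never starts with an ascent. This
    removes the merge term of the first block, which has no predecessor. *)
Lemma descent_count_false u : descent_count (false :: u) = 0.
Proof.
rewrite /descent_count -[RHS](count_pred0 (permutations (iota 0 (size u).+1))).
apply: eq_in_count => -[|x w] //; rewrite mem_permutations => /perm_mem/(_ x).
by rewrite mem_head mem_iota /= add0n => /esym ->.
Qed.

(** * Descent words of types *)

Lemma size_descent_word s : all (leq 1) s -> size (descent_word s) = sumn s.
Proof.
by elim: s => //= -[|x] s IHs //= /IHs; rewrite size_cat size_nseq addSn => <-.
Qed.

Lemma descent_word_cat s t : descent_word (s ++ t) = descent_word s ++ descent_word t.
Proof. by rewrite /descent_word map_cat flatten_cat. Qed.

(** The letters [true] mark the block starts, which are the partial sums of [s]; all other summands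
    vanish. *)
Lemma sum_descent_word (F : nat -> nat) s : all (leq 1) s ->
  \sum_(k < sumn s) nth false (descent_word s) k * F k
  = \sum_(j < size s) F (sumn (take j s)).
Proof.
elim: s F => [|[|x] s IHs] F //=; first by rewrite !big_ord0.
move=> sP; rewrite addSn !big_ord_recl /= mul1n; congr addn.
rewrite -(IHs (fun k => F (x.+1 + k))) // big_split_ord /=.
rewrite big1 ?add0n => [|i _]; last by rewrite nth_cat size_nseq ltn_ord nth_nseq ltn_ord.
apply: eq_bigr => i _.
by rewrite nth_cat size_nseq add0n ltnNge leq_addr /= addKn.
Qed.

Lemma decrease_cat a x b :
  decrease (a ++ x :: b) (size a) =
  a ++ (if x == 1 then [::] else [:: x - 1]) ++ b.
Proof.
rewrite /decrease take_size_cat // nth_cat ltnn subnn /= -cat_rcons.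
by rewrite drop_size_cat ?size_rcons.
Qed.

Lemma merge_next_cat a y x b :
  merge_next (a ++ [:: y, x & b]) (size a) = a ++ (y + x - 1) :: b.
Proof.
rewrite /merge_next take_size_cat // !nth_cat ltnn subnn ltnNge leqnSn /=.
rewrite subSnn /= -(cat1s y) -(cat1s x) !catA.
by rewrite drop_size_cat // !size_cat /= !addn1.
Qed.

(** The minimum opens block [j]. Once it is removed, the free letter at this place decides: [true]
    keeps block [j] separate with one element less, [false] glues its remainder to block [j.-1]. *)
Lemma insertion_count_boundary s j : all (leq 1) s -> j < size s ->
  insertion_count (descent_word s) (sumn (take j s)) =
  (if (1 < nth 0 s j) || (j.+1 == size s)
   then descent_count (descent_word (decrease s j)) else 0)
  + (if (0 < j) && (1 < nth 0 s j)
     then descent_count (descent_word (merge_next s j.-1)) else 0).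
Proof.
move=> sP lt_js; rewrite /insertion_count size_descent_word //.
have [a [x [b [sE ja]]]] : exists a x b, s = a ++ x :: b /\ j = size a.
  exists (take j s), (nth 0 s j), (drop j.+1 s).
  by rewrite -drop_nth // cat_take_drop size_takel // ltnW.
move: sP; rewrite {s}sE {j}ja all_cat /= in lt_js * => /and3P[aP x0 bP].
rewrite decrease_cat take_size_cat // nth_cat ltnn subnn /= sumn_cat size_cat /=.
have szU : size (descent_word a) = sumn a by rewrite size_descent_word.
have dropU m w : drop (sumn a + m) (descent_word a ++ w) = drop m w.
  by rewrite drop_cat szU ltnNge leq_addr /= addKn.
have nthU m w : nth false (descent_word a ++ w) (sumn a + m) = nth false w m.
  by rewrite nth_cat szU ltnNge leq_addr /= addKn.
rewrite descent_word_cat take_size_cat //.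
rewrite -[(sumn a).+2]addn2 -[(sumn a).+1]addn1 -[(size a).+1]addn1 dropU nthU !eqn_add2l.
(* After a block of size 1 the next letter, if any, opens a block and is [true], so the count is 0;
   if there is none, the block is last and gets deleted. *)
case: x x0 {lt_js} => [|[|x]] // _.
  rewrite andbF addn0 /=.
  by case: (b) bP => [|[|y] b'] //= _; rewrite cats0.
rewrite subn1 /= andbT; congr addn; first by rewrite descent_word_cat drop0.
(* With no block before [x], the merged pattern would start with [false]. *)
case/lastP: a aP {szU dropU nthU} => [|a [|y]] /=; first by rewrite descent_count_false.
  by rewrite all_rcons.
move=> _; rewrite size_rcons /= cat_rcons merge_next_cat -cats1 !descent_word_cat.
rewrite {2}/descent_word /= cats0 -catA /= drop0.
have -> : y.+1 + x.+2 - 1 = (y + x.+1).+1 by lia.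
by rewrite /descent_word /= nseqD -catA.
Qed.

(** * From sequences of blocks to words *)

Lemma path_leq_descents x b :
  (descents x b == nseq (size b) false) = path leq x b.
Proof.
by elim: b x => //= y b IHb x; rewrite eqseq_cons IHb eqbF_neg -leqNgt.
Qed.

(** Letters inside a block say that it is sorted; the letter opening a block is the crossing
    condition with the block before it. Here [c] is a virtual block preceding the first one. *)
Lemma descents_flatten c bs : all (fun b => b != [::]) bs ->
  (descents (last 0 c) (flatten bs) == descent_word (shape bs))
  = all (sorted leq) bs && path (fun b b' => head 0 b' < last 0 b) c bs.
Proof.
elim: bs c => [|[|y b] bs IHbs] c //= bsP.
rewrite descents_cat /= eqseq_cons eqb_id eqseq_cat ?size_descents ?size_nseq //.
rewrite path_leq_descents -[last y b]/(last 0 (y :: b)) IHbs // andbCA -!andbA.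
by do !bool_congr.
Qed.

Definition block_word n (B : {set 'I_n}) : seq nat := [seq val x | x <- enum B].

Lemma mem_block_word n (B : {set 'I_n}) (p : 'I_n) : (val p \in block_word B) = (p \in B).
Proof. by rewrite mem_map ?mem_enum //; apply: val_inj. Qed.

Lemma size_block_word n (B : {set 'I_n}) : size (block_word B) = #|B|.
Proof. by rewrite size_map cardE. Qed.

Lemma block_word_sorted n (B : {set 'I_n}) : sorted ltn (block_word B).
Proof.
rewrite /block_word sorted_map /enum_mem sorted_filter //.
  by move=> y x z; apply: ltn_trans.
by rewrite -enumT -sorted_map val_enum_ord iota_ltn_sorted.
Qed.

Lemma block_word_inj n : injective (@block_word n).
Proof. by move=> A B eqAB; apply/setP=> p; rewrite -!mem_block_word eqAB. Qed.

Lemma block_word_eq0 n (B : {set 'I_n}) : (block_word B == [::]) = (B == set0).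
Proof. by rewrite -size_eq0 size_block_word cards_eq0. Qed.

Lemma block_max_last n (B : {set 'I_n}) : block_max B = last 0 (block_word B).
Proof.
rewrite /block_max -big_enum /= -(big_map val xpredT id) -/(block_word B).
case: (block_word B) (block_word_sorted B) => [|x b] /=; first by rewrite big_nil.
elim: b x => [|y b IHb] x /=; first by rewrite big_seq1.
case/andP=> lt_xy syb; rewrite big_cons IHb //; apply/maxn_idPr.
by rewrite -IHb // big_cons (leq_trans (ltnW lt_xy)) ?leq_maxl.
Qed.

(** [minn] has no neutral element in [nat], so it is registered as a semigroup law only. *)
HB.instance Definition _ := SemiGroup.isComLaw.Build nat minn minnA minnC.

Lemma block_min_head n (B : {set 'I_n}) : B != set0 -> block_min B = head 0 (block_word B).
Proof.
rewrite -block_word_eq0 /block_min -big_enum /= -(big_map val xpredT id) -/(block_word B).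
have: all (gtn n) (block_word B) by apply/allP => _ /mapP[x _ ->] /=.
elim: (block_word B) (block_word_sorted B) => //= x [|y b] IHb.
  by rewrite big_cons big_nil andbT => _ /ltnW/minn_idPl.
rewrite big_cons => /= /andP[lt_xy syb] /andP[_ lt_n] _.
by rewrite IHb //=; apply/minn_idPl/ltnW.
Qed.

Definition word_of n (pi : seq {set 'I_n}) : seq nat := flatten (map (@block_word n) pi).

Lemma shape_block_words n (pi : seq {set 'I_n}) :
  shape (map (@block_word n) pi) = [seq #|B| | B : {set 'I_n} <- pi].
Proof. by rewrite /shape -map_comp; apply: eq_map => B /=; rewrite size_block_word. Qed.

(** Block words have no repetitions, so the multiplicity of [p] in the word is the number of blocks
    containing [p]. *)
Lemma perm_word_of n (pi : seq {set 'I_n}) :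
  perm_eq (word_of pi) (iota 0 n)
  = [forall p : 'I_n, count (fun B : {set 'I_n} => p \in B) pi == 1].
Proof.
have cnt (p : 'I_n) :
    count_mem (val p) (word_of pi) = count (fun B : {set 'I_n} => p \in B) pi.
  rewrite count_flatten -map_comp -sumn_count; congr sumn; apply: eq_map => B /=.
  by rewrite count_uniq_mem ?mem_block_word // (sorted_uniq ltn_trans ltnn) ?block_word_sorted.
have cnt_iota (p : 'I_n) : count_mem (val p) (iota 0 n) = 1.
  by rewrite count_uniq_mem ?iota_uniq // mem_iota /= add0n ltn_ord.
apply/idP/forallP => [/permP wP p | piP]; first by rewrite -cnt wP cnt_iota.
(* [perm_eq] compares multiplicities only at entries of the two words, and these are all below
   [n]. *)
apply/allP => x; rewrite mem_cat => xP.
have ltxn : x < n.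
  case/orP: xP => [/flatten_mapP[B _ /mapP[y _ ->]] | ]; first exact: ltn_ord.
  by rewrite mem_iota.
by have := piP (Ordinal ltxn); rewrite -cnt -(cnt_iota (Ordinal ltxn)).
Qed.

Lemma descents_word_of n (pi : seq {set 'I_n}) :
  all (fun B : {set 'I_n} => B != set0) pi ->
  (descents n (word_of pi) == descent_word [seq #|B| | B : {set 'I_n} <- pi])
  = sorted (fun A B : {set 'I_n} => block_max A > block_min B) pi.
Proof.
move=> pi0; rewrite -shape_block_words -[X in descents X]/(last 0 [:: n]).
rewrite descents_flatten; last first.
  by rewrite all_map; apply: sub_all pi0 => B /=; rewrite block_word_eq0.
have -> : all (sorted leq) (map (@block_word n) pi).
  rewrite all_map; apply/allP => B _ /=.
  exact: sub_sorted (@ltnW) _ (block_word_sorted B).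
case: pi pi0 => //= B pi /andP[B0 pi0].
(* The crossing condition with the virtual block [[:: n]] always holds. *)
have -> : head 0 (block_word B) < n.
  have:= B0; rewrite -block_word_eq0; case def_b: (block_word B) => [//|x b] _ /=.
  have /mapP[y _ ->] : x \in block_word B by rewrite def_b mem_head.
  exact: ltn_ord.
elim: pi B {B0} pi0 => //= C pi IHpi B /andP[C0 pi0].
by rewrite block_max_last block_min_head // -IHpi.
Qed.

Lemma block_word_set n (b : seq nat) :
  sorted ltn b -> {subset b <= gtn n} -> block_word [set x : 'I_n | val x \in b] = b.
Proof.
move=> sb ltb; apply: (irr_sorted_eq ltn_trans ltnn) => //; first exact: block_word_sorted.
move=> x; apply/mapP/idP => [[y] | xb]; first by rewrite mem_enum inE => yb ->.
by exists (Ordinal (ltb x xb)); rewrite // mem_enum inE.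
Qed.

(** Cut [w] into pieces of lengths [s]. The descent condition makes each piece weakly increasing,
    and strictly so since [w] has no repetitions; hence each piece is the word of its set of
    entries. *)
Lemma word_of_surj n s w : all (leq 1) s -> perm_eq w (iota 0 n) ->
  descents n w == descent_word s -> sumn s = n ->
  exists2 pi : seq {set 'I_n}, [seq #|B| | B : {set 'I_n} <- pi] = s & word_of pi = w.
Proof.
move=> s0 wP dw sn.
have sw : size w = sumn s by rewrite (perm_size wP) size_iota sn.
have bsw : flatten (reshape s w) = w by rewrite reshapeKr ?sw.
have shs : shape (reshape s w) = s by rewrite reshapeKl ?sw.
have [all_sorted _] : all (sorted leq) (reshape s w) /\
    path (fun b b' => head 0 b' < last 0 b) [:: n] (reshape s w).
  apply/andP; rewrite -descents_flatten /= ?shs ?bsw //.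
  apply/allP => b bP; have: size b \in s by rewrite -shs map_f.
  by move/(allP s0); case: b {bP}.
have wordK :
    map (@block_word n) [seq [set x : 'I_n | val x \in b] | b <- reshape s w] = reshape s w.
  rewrite -map_comp; apply: map_id_in => b bP.
  have sub_bw : {subset b <= w} by move=> x xb; rewrite -bsw; apply/flattenP; exists b.
  apply: block_word_set => [|x /sub_bw]; last by rewrite (perm_mem wP) mem_iota.
  rewrite ltn_sorted_uniq_leq (allP all_sorted) // andbT.
  have: uniq w by rewrite (perm_uniq wP) iota_uniq.
  rewrite -bsw; elim: (reshape s w) bP => //= c bs IHbs; rewrite inE cat_uniq.
  by case/predU1P=> [-> | /IHbs Ib] /and3P[].
exists [seq [set x : 'I_n | val x \in b] | b <- reshape s w].
  by rewrite -shape_block_words wordK.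
by rewrite /word_of wordK.
Qed.

Lemma word_of_inj n (pi pi' : seq {set 'I_n}) :
  [seq #|B| | B : {set 'I_n} <- pi] = [seq #|B| | B : {set 'I_n} <- pi'] ->
  word_of pi = word_of pi' -> pi = pi'.
Proof.
rewrite -!shape_block_words => eq_sh eq_w.
apply: (inj_map (@block_word_inj n)); exact: eq_from_flatten_shape.
Qed.

(** For a fixed type, [word_of] is a bijection onto the permutations with descent word
    [descent_word s]. *)
Lemma T_descent_count s : all (leq 1) s -> T s = descent_count (descent_word s).
Proof.
move=> s0; rewrite /T /descent_count size_descent_word // cardE -size_filter.
set n := sumn s.
pose f (pi : (size s).-tuple {set 'I_n}) := word_of pi.
rewrite -(size_map f); apply/perm_size/uniq_perm.
- rewrite map_inj_in_uniq ?enum_uniq // => pi pi'.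
  rewrite !mem_enum !inE => /andP[_ /eqP ty] /andP[_ /eqP ty'] eq_w.
  by apply/val_inj/word_of_inj => //; rewrite ty ty'.
- by rewrite filter_uniq ?permutations_uniq.
have crossingE (pi : seq {set 'I_n}) : has_type pi s ->
    nc_crossing_partition pi
    = perm_eq (word_of pi) (iota 0 n) && (descents n (word_of pi) == descent_word s).
  move=> /eqP ty; rewrite /nc_crossing_partition -perm_word_of.
  have pi0 : all (fun B : {set 'I_n} => B != set0) pi.
    apply/allP => B BP; rewrite -card_gt0; apply: (allP s0).
    by rewrite -ty (map_f (fun B : {set 'I_n} => #|B|)).
  by rewrite pi0 -ty descents_word_of.
move=> w; rewrite mem_filter mem_permutations; apply/mapP/andP => [[pi] | [dw wP]].
  by rewrite mem_enum inE => /andP[+ ty] ->; rewrite crossingE // => /andP[].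
have [pi ty def_w] := word_of_surj s0 wP dw erefl.
have sz : size pi == size s by rewrite -ty size_map.
exists (Tuple sz) => //; rewrite mem_enum inE crossingE /has_type ?ty ?eqxx //.
by rewrite def_w wP dw.
Qed.

(** * The recursion for types *)

Lemma decrease_gt0 s j : all (leq 1) s -> j < size s -> all (leq 1) (decrease s j).
Proof.
move=> s0 lt_js; rewrite /decrease !all_cat.
have sub_all t : {subset t <= s} -> all (leq 1) t by move=> ts; apply/allP => x /ts/(allP s0).
rewrite (sub_all _ (@mem_take _ _ _)) (sub_all _ (@mem_drop _ _ _)) andbT /=.
by case: (nth 0 s j) (all_nthP 0 s0 j lt_js) => [|[|x]].
Qed.

Lemma merge_next_gt0 s j : all (leq 1) s -> j.+1 < size s -> all (leq 1) (merge_next s j).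
Proof.
move=> s0 lt_js; rewrite /merge_next all_cat /=.
have sub_all t : {subset t <= s} -> all (leq 1) t by move=> ts; apply/allP => x /ts/(allP s0).
rewrite (sub_all _ (@mem_take _ _ _)) (sub_all _ (@mem_drop _ _ _)) andbT /=.
have := all_nthP 0 s0 j (ltnW lt_js); have := all_nthP 0 s0 j.+1 lt_js.
by lia.
Qed.

Theorem lemma2p12 :
  T [:: 1] = 1 /\
  forall s : seq nat,
    s <> [::] ->
    (forall x : nat, x \in s -> 0 < x) ->
    s <> [:: 1] ->
    T s = \sum_(i in S1 s) T (decrease s i) + \sum_(i in S2 s) T (merge_next s i).
Proof.
split=> [|s s_neq0 s_gt0 _]; first by rewrite T_descent_count.
have s0 : all (leq 1) s by apply/allP.
rewrite T_descent_count // descent_count_rec; last first.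
  by case: s s_neq0 {s_gt0 s0}.
rewrite size_descent_word // (sum_descent_word (insertion_count _)) //.
rewrite (eq_bigr _ (fun j _ => insertion_count_boundary s0 (ltn_ord j))).
rewrite big_split /=; congr addn.
  rewrite [RHS]big_mkcond /=; apply: eq_bigr => j _; rewrite !inE.
  rewrite T_descent_count ?decrease_gt0 //.
  case: (eqVneq j.+1 (size s)) => [_ | nej]; first by rewrite !orbT.
  by rewrite !orbF (ltn_neqAle j.+1) nej ltn_ord.
rewrite [RHS]big_mkcond /=.
have S2E (i : 'I_(size s)) : (if i \in S2 s then T (merge_next s i) else 0)
    = if (i.+1 < size s) && (1 < nth 0 s i.+1)
      then descent_count (descent_word (merge_next s i)) else 0.
  by rewrite inE; case: ifP => // /andP[lt_is _]; rewrite T_descent_count ?merge_next_gt0.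
rewrite (eq_bigr _ (fun i _ => S2E i)).
(* Merge terms are indexed by the second block on the left and by the first on the right. Dropping
   the zero terms, at the first and the last index respectively, aligns the sums. *)
case: (size s) => [|n]; first by rewrite !big_ord0.
rewrite big_ord_recl big_ord_recr /= ltnn addn0 add0n.
by apply: eq_bigr => i _; rewrite ltnS ltn_ord.
Qed.
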